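(* Let $\lfloor\cdot\rceil$ be the shifted Hurwitz choice function, which assigns to $z\in\mathbb{C}$ a point $h\in\mathbb{Z}[i]$ with $|z-h|\le1$ for which $|z-h+\tfrac12|$ is minimal among such points, and let $K=\overline{\{z-\lfloor z\rceil\}}$ be its fundamental set. Define $$K_1=\{z\in K:-\tfrac12\le\operatorname{Re}z\le0,\ |z-i|\ge1,\ |z+i|\ge1\},$$ $$K_2=\{z\in K:|z-i|\le1,\ |z+1|\le1,\ |z-(-1+i)|\ge1\},$$ $$K_3=\{z\in K:0\le\operatorname{Im}z\le\tfrac12,\ |z-1|\ge1,\ |z+1|\ge1\},$$ $$K_4=\{z\in K:\operatorname{Re}z\ge-\tfrac12,\ |z-(-1+i)|\le1\},$$ $$K_5=\{z\in K:\operatorname{Re}z\le-\tfrac12,\ |z-(-1+i)|\le1\},$$ $$K_6=\{z\in K:\operatorname{Re}z\le-\tfrac12,\ |z-(-1+i)|\ge1,\ |z-(-1-i)|\ge1\},$$ $$K_j=\{\overline z:z\in K_{j-5}\}\quad\text{for }j=7,8,9,10.$$ Then the shifted Hurwitz algorithm satisfies the finite building property with $\mathcal{P}=\{K_1,\dots,K_{10}\}$.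
   Context: Here $i=\sqrt{-1}$. (The convention used for ties in the choice function affects only a null set.) The Gauss map $G:K\to K$ is $G(z)=-1/z-\lfloor-1/z\rceil$ for $z\neq0$, $G(0)=0$. A finite partition of $K$ is a finite collection of closed sets with boundaries of zero Lebesgue measure and pairwise disjoint interiors whose union is $K$. A set is buildable from a collection $\mathcal{C}$ of closed sets (with null boundaries) if it is equal, up to measure zero, to some union of elements of $\mathcal{C}$. The algorithm satisfies the finite building property with $\mathcal{P}=\{K_1,\dots,K_N\}$ if $N>1$, $\mathcal{P}$ is a finite partition of $K$, and each $G(K_j)$ is buildable from $\mathcal{P}$. *)

(* Defs.v *)
From HB Require Import structures.
From mathcomp Require Import all_boot all_order all_algebra.
From mathcomp Require Import all_classical all_reals all_analysis.
From mathcomp Require Import complex.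

Set Implicit Arguments.
Unset Strict Implicit.
Unset Printing Implicit Defensive.

Import Order.TTheory GRing.Theory Num.Theory.
Import numFieldNormedType.Exports.

Local Open Scope classical_set_scope.
Local Open Scope complex_scope.
Local Open Scope ring_scope.

(* Norms of complex numbers live in [R[i]], and [x <= y] on [R[i]] means that
   [y - x] is a nonnegative real, so that comparing norms in [R[i]] is the usual
   comparison of real moduli. *)

Section Plane.
Context {R : realType}.
Implicit Types A B : set R[i].

(* The topology is carried by the alias [R[i]^o]. *)
Definition cclosure A : set R[i] := closure (A : set R[i]^o).
Definition cinterior A : set R[i] := interior (A : set R[i]^o).
Definition cclosed A : Prop := closed (A : set R[i]^o).
Definition cboundary A : set R[i] := cclosure A `\` cinterior A.

(* [negligible]: contained in a measurable set of measure zero. *)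
Definition cnull A : Prop :=
  ((@lebesgue_measure R) \x (@lebesgue_measure R))%E.-negligible
    [set p : R * R | A (p.1 +i* p.2)].

Definition eq_mod_null A B : Prop := cnull ((A `\` B) `|` (B `\` A)).

Definition gaussian_integer : set R[i] :=
  [set h | complex.Re h \is a Num.int /\ complex.Im h \is a Num.int].

End Plane.

Section Algorithm.
Context {R : realType}.
Implicit Types (fl : R[i] -> R[i]) (A : set R[i]).

Definition fundamental_set fl : set R[i] :=
  cclosure [set z - fl z | z in [set: R[i]]].

Definition gauss_map fl (z : R[i]) : R[i] :=
  if z == 0 then 0 else - 1 / z - fl (- 1 / z).

Definition finite_partition A (N : nat) (P : 'I_N -> set R[i]) : Prop :=
  [/\ forall j, cclosed (P j) /\ cnull (cboundary (P j)),
      forall i j, i != j -> cinterior (P i) `&` cinterior (P j) = set0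
    & \bigcup_j P j = A].

Definition buildable A (N : nat) (P : 'I_N -> set R[i]) : Prop :=
  exists J : set 'I_N, eq_mod_null A (\bigcup_(j in J) P j).

Definition finite_building_property fl (N : nat) (P : 'I_N -> set R[i]) : Prop :=
  [/\ (1 < N)%N, finite_partition (fundamental_set fl) P
    & forall j, buildable (gauss_map fl @` P j) P].

End Algorithm.

Section ShiftedHurwitz.
Context {R : realType}.

(* A predicate rather than a single function: ties may be broken arbitrarily. *)
Definition shifted_hurwitz (fl : R[i] -> R[i]) : Prop :=
  forall z, [/\ gaussian_integer (fl z), `|z - fl z| <= 1
    & forall h, gaussian_integer h -> `|z - h| <= 1 ->
        `|z - fl z + 1 / 2| <= `|z - h + 1 / 2| ].

Section Pieces.
Variable K : set R[i].
Notation Re := (@complex.Re R).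
Notation Im := (@complex.Im R).

Definition sh1 : set R[i] :=
  [set z | [/\ K z, - (1 / 2) <= Re z <= 0, `|z - 'i%C| >= 1 & `|z + 'i%C| >= 1] ].
Definition sh2 : set R[i] :=
  [set z | [/\ K z, `|z - 'i%C| <= 1, `|z + 1| <= 1 & `|z - (-1 + 'i%C)| >= 1] ].
Definition sh3 : set R[i] :=
  [set z | [/\ K z, 0 <= Im z <= 1 / 2, `|z - 1| >= 1 & `|z + 1| >= 1] ].
Definition sh4 : set R[i] :=
  [set z | [/\ K z, Re z >= - (1 / 2) & `|z - (-1 + 'i%C)| <= 1] ].
Definition sh5 : set R[i] :=
  [set z | [/\ K z, Re z <= - (1 / 2) & `|z - (-1 + 'i%C)| <= 1] ].
Definition sh6 : set R[i] :=
  [set z | [/\ K z, Re z <= - (1 / 2), `|z - (-1 + 'i%C)| >= 1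
             & `|z - (-1 - 'i%C)| >= 1] ].
Definition conj_set (A : set R[i]) : set R[i] := [set conjc z | z in A].

Definition sh_pieces (j : 'I_10) : set R[i] :=
  nth set0 [:: sh1; sh2; sh3; sh4; sh5; sh6;
    conj_set sh2; conj_set sh3; conj_set sh4; conj_set sh5] j.

End Pieces.
End ShiftedHurwitz.

(* Main.v *)
(* All constraints occurring here have the form a |z|^2 + b Re z + c Im z + d >= 0
   with integer coefficients, and this form is preserved by z |-> -1 / z and by
   Gaussian translations.  The fundamental set is
   {|z| <= 1, |Im z| <= 1/2, (Re z <= 0 or |z - 1| >= 1)}, and each K_j is cut out
   by finitely many such constraints.  Off the null union of the boundary curves, a
   point w of the fundamental set satisfies fl (w + h) = h for every Gaussian h, so
   w lies in G(K_j) as soon as -1 / (w + h) lies in K_j for some h, and explicit h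
   show that G(K_j) contains the union below.  Up to null sets G(K_j) = K, except that
   G(K_5) = G(K_10) = K_3 u K_4 u K_5 u K_8 u K_9 u K_10 and
   G(K_6) = K_1 u K_2 u K_6 u K_7; in these cases the constraint |-1/z - 1| <= 1
   leaves finitely many h, each incompatible with the other pieces. *)
Require Import Defs.
From mathcomp Require Import all_boot all_order all_algebra.
From mathcomp Require Import all_classical all_reals all_analysis.
From mathcomp Require Import measurable_realfun complex.
From mathcomp Require Import ring lra zify.

Set Implicit Arguments.
Unset Strict Implicit.
Unset Printing Implicit Defensive.

Import Order.TTheory GRing.Theory Num.Theory.
Import numFieldNormedType.Exports.

Local Open Scope classical_set_scope.
Local Open Scope complex_scope.
Local Open Scope ring_scope.

(** * Topology and null sets of the plane in real coordinates *)

Section Plane.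
Context {R : realType}.
Implicit Types (x y : R) (z w : R[i]) (A B : set R[i]).
Notation Re := (@complex.Re R).
Notation Im := (@complex.Im R).

Lemma normc_le1 z : (`|z| <= 1) = (Re z ^+ 2 + Im z ^+ 2 <= 1).
Proof.
by rewrite normc_def -[1 in LHS]/(1%:C) lecR /= -[1 in LHS]sqrtr1 ler_sqrt.
Qed.

Lemma normc_ge1 z : (1 <= `|z|) = (1 <= Re z ^+ 2 + Im z ^+ 2).
Proof.
rewrite normc_def -[1 in LHS]/(1%:C) lecR /= -[1 in LHS]sqrtr1 ler_sqrt//.
by rewrite addr_ge0// sqr_ge0.
Qed.

Lemma box_in_disc (u v r : R) : `|u| < r / 2 -> `|v| < r / 2 -> u ^+ 2 + v ^+ 2 < r ^+ 2.
Proof.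
rewrite !ltr_norml => /andP[? ?] /andP[? ?].
have ha : 0 < (r / 2 - u) * (r / 2 + u) by apply: mulr_gt0; lra.
have hb : 0 < (r / 2 - v) * (r / 2 + v) by apply: mulr_gt0; lra.
nra.
Qed.

(** Ball radii are elements of [R[i]], and a positive one has zero imaginary part. Boxes with a real
    radius replace balls from here on. *)
Lemma nbhs_planeP z A : nbhs (z : R[i]^o) (A : set R[i]^o) <->
  exists2 e : R, 0 < e &
    forall w, `|Re w - Re z| < e -> `|Im w - Im z| < e -> A w.
Proof.
split=> [/nbhs_ballP[[r i]]|[e e0 eA]].
  rewrite /= ltcE /= => /andP[/eqP -> r0] eA.
  exists (r / 2) => [|w wx wy]; first by rewrite divr_gt0.
  apply: eA; rewrite -ball_normE /= normc_def ltcR.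
  rewrite -[X in _ < X](gtr0_norm r0) -sqrtr_sqr ltr_sqrt ?exprn_gt0//.
  case: z w wx wy => [x y] [a b] /= wx wy.
  by apply: box_in_disc; rewrite distrC.
apply/nbhs_ballP; exists e%:C; first by rewrite /= ltcR.
move=> w; rewrite -ball_normE /= normc_def ltcR => zw.
case: z w eA zw => [x y] [a b] eA /= zw; apply: eA => /=; apply: le_lt_trans zw;
  rewrite distrC -sqrtr_sqr ler_sqrt ?addr_ge0 ?sqr_ge0//.
  by rewrite lerDl sqr_ge0.
by rewrite lerDr sqr_ge0.
Qed.

Lemma cclosureP z A : cclosure A z <-> forall e, 0 < e ->
  exists w, [/\ A w, `|Re w - Re z| < e & `|Im w - Im z| < e].
Proof.
split=> [zA e e0|H B /nbhs_planeP[e e0 eB]].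
  have /zA[w [Aw [? ?]]] : nbhs (z : R[i]^o)
    [set w : R[i]^o | `|Re w - Re z| < e /\ `|Im w - Im z| < e].
    by apply/nbhs_planeP; exists e.
  by exists w.
by have [w [Aw wx wy]] := H e e0; exists w; split=> //; exact: eB.
Qed.

(** Tonelli: the product measure integrates the measures of the vertical sections, which vanish off
    the null set [N]. *)
Lemma negligible_fiber (S : set (R * R)) (N : set R) : measurable S ->
  countable N -> (forall x, ~ N x -> countable (xsection S x)) ->
  ((@lebesgue_measure R) \x (@lebesgue_measure R))%E.-negligible S.
Proof.
move=> mS cN cS; exists S; split=> //; rewrite /= /product_measure1.
rewrite (ae_eq_integral (cst 0%E))//=.
- by rewrite integral0.
- exact: measurable_fun_xsection.
exists N; split.
- exact: countable_measurable.
- exact: countable_lebesgue_measure0.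
move=> x /= H; apply: contrapT => Nx; apply: H => _.
by apply/countable_lebesgue_measure0/cS.
Qed.

End Plane.

(** * Cells cut out by circles and lines with integer coefficients *)

Section Quad.
Context {R : realType}.
Implicit Types (x y : R) (z w : R[i]) (A B : set R[i]).
Notation Re := (@complex.Re R).
Notation Im := (@complex.Im R).

Definition quad : Type := int * int * int * int.
Implicit Types (q : quad) (l : seq quad).

Definition qev q x y : R :=
  let: (a, b, c, d) := q in
  a%:~R * (x ^+ 2 + y ^+ 2) + b%:~R * x + c%:~R * y + d%:~R.

Definition qopp q : quad := let: (a, b, c, d) := q in (- a, - b, - c, - d).

Definition qnonconst q := let: (a, b, c, _) := q in [|| a != 0, b != 0 | c != 0].

Definition holds l x y := all (fun q => 0 <= qev q x y) l.
Definition cell l : set R[i] := [set z | holds l (Re z) (Im z)].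

Lemma qev_opp q x y : qev (qopp q) x y = - qev q x y.
Proof. by case: q => [[[a b] c] d]; rewrite /qev /qopp !rmorphN; ring. Qed.

Lemma qev_near q z : 0 < qev q (Re z) (Im z) ->
  nbhs (z : R[i]^o) [set w | 0 < qev q (Re w) (Im w)].
Proof.
case: z => x y /= q0.
have qc : {for (x, y), continuous (fun p : R * R => qev q p.1 p.2)}.
  case: q {q0} => [[[a b] c] d]; rewrite /qev.
  have c1 : {for (x, y), continuous (fst : R * R -> R)} by exact: cvg_fst.
  have c2 : {for (x, y), continuous (snd : R * R -> R)} by exact: cvg_snd.
  apply: continuousD; last exact: cst_continuous.
  apply: continuousD; last by apply: continuousM => //; exact: cst_continuous.
  apply: continuousD; last by apply: continuousM => //; exact: cst_continuous.
  apply: continuousM; first exact: cst_continuous.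
  by apply: continuousD; [exact: (continuousM c1 c1)|exact: (continuousM c2 c2)].
have /qc : nbhs (qev q (x, y).1 (x, y).2) [set r : R | 0 < r].
  exact: lt_nbhsr.
move=> /nbhs_ballP[e /= e0 eq]; apply/nbhs_planeP; exists e => // w wx wy.
by apply: (eq (Re w, Im w)); split; rewrite /ball/= distrC.
Qed.

Lemma cclosed_cell l : cclosed (cell l).
Proof.
move=> z zl; apply/allP => q ql; rewrite leNgt -oppr_gt0 -qev_opp; apply/negP.
by move=> /qev_near/zl[w [/allP/(_ _ ql)]] /=; rewrite qev_opp; lra.
Qed.

Lemma cell_near l z : (forall q, q \in l -> 0 < qev q (Re z) (Im z)) ->
  cinterior (cell l) z.
Proof.
elim: l => [|q l IH] ql; first exact: filterS filterT.
have ql' : forall p, p \in l -> 0 < qev p (Re z) (Im z).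
  by move=> p pl; apply: ql; rewrite inE pl orbT.
have := qev_near (ql q (mem_head _ _)).
move: (IH ql'); rewrite /cinterior /interior /=; apply: filterS2 => w h1 h2.
by rewrite /cell /holds /= ltW.
Qed.

Definition on_curves l : set R[i] := [set z | has (fun q => qev q (Re z) (Im z) == 0) l].

Lemma cell_generic l l' z : {subset l <= l'} -> ~ on_curves l' z ->
  cell l z -> forall q, q \in l -> 0 < qev q (Re z) (Im z).
Proof.
move=> ll' /negP/hasPn zl' /allP zl q ql.
by rewrite lt_neqAle zl// eq_sym zl'// ll'.
Qed.

Lemma cboundary_cell l : cboundary (cell l) `<=` on_curves l.
Proof.
move=> z [/cclosed_cell zl zNi]; apply: contrapT => zN; apply: zNi.
by apply: cell_near; apply: cell_generic zN zl.
Qed.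

(** On each vertical line the equation is a polynomial of degree at most 2 in [y]. It has at most
    two roots unless it vanishes identically, which happens only for [x] in [N], a set of at most
    one point. *)
Lemma qzero_null q : qnonconst q -> cnull [set z | qev q (Re z) (Im z) = 0].
Proof.
case: q => [[[a b] c] d] /= q0; rewrite /cnull /=.
pose N : set R := [set x | [/\ a = 0, c = 0 & b%:~R * x + d%:~R = 0]].
apply: (@negligible_fiber _ _ N).
- set f := fun p : R * R => qev (a, b, c, d) p.1 p.2.
  rewrite [X in measurable X](_ : _ = f @^-1` [set 0])//.
  rewrite -[X in measurable X]setTI.
  have mf : measurable_fun setT f; last exact: mf.
  have m1 : measurable_fun setT (fst : R * R -> R) by exact: measurable_fst.
  have m2 : measurable_fun setT (snd : R * R -> R) by exact: measurable_snd.
  apply: measurable_funD; last exact: measurable_cst.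
  apply: measurable_funD; last by apply: measurable_funM.
  apply: measurable_funD; last by apply: measurable_funM.
  apply: measurable_funM => //.
  by apply: measurable_funD; apply: measurable_funX.
- apply: (@sub_countable _ _ _ [set - d%:~R / b%:~R]); last exact: countable1.
  apply: subset_card_le => x [a0 c0 bx] /=.
  have b0 : b%:~R != 0 :> R by move: q0; rewrite a0 c0 !eqxx orbF intr_eq0.
  by apply: (mulfI b0); rewrite [RHS]mulrC divfK//; lra.
- move=> x Nx; have [[y0 /xsectionP/= h0]|h] := pselect (exists y,
    xsection [set p : R * R | qev (a, b, c, d) p.1 p.2 = 0] x y); last first.
    rewrite (_ : xsection _ _ = set0) ?countable0//.
    by apply/seteqP; split => // y xy; apply: h; exists y.
  apply: (@sub_countable _ _ _ [set y0; - c%:~R / a%:~R - y0]); last first.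
    exact: finite_set_countable.
  apply: subset_card_le => y /xsectionP/= hy.
  have : (y - y0) * (a%:~R * (y + y0) + c%:~R) = 0 by lra.
  move=> /eqP; rewrite mulf_eq0 => /orP[/eqP ?|/eqP hs]; first by left; lra.
  have [a0|a0] := eqVneq a 0.
    exfalso; apply: Nx; move: hs; rewrite a0 mulr0z mul0r add0r => hs.
    move: h0; rewrite a0 mulr0z hs !mul0r add0r addr0 => h0.
    by split=> //; apply/eqP; rewrite -(intr_eq0 R) hs.
  right; have a0' : a%:~R != 0 :> R by rewrite intr_eq0.
  by apply: (mulfI a0'); rewrite mulrBr [_ * (_ / _)]mulrC divfK//; lra.
Qed.

Lemma on_curves_null l : all qnonconst l -> cnull (on_curves l).
Proof.
elim: l => [_|q l IH /= /andP[q0 /IH l0]].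
  rewrite (_ : on_curves _ = set0)//; first exact: negligible_set0.
  by apply/seteqP; split.
have := negligibleU (qzero_null q0) l0; apply: negligibleS => p /=.
by move=> /orP[/eqP|]; [left|right].
Qed.

(** Finite differences with step [t] isolate the coefficients: the second difference in [x] gives
    [a], then first differences in [x] and [y] give [b] and [c]. *)
Lemma qev_box0 q x y (e : R) : qnonconst q -> 0 < e ->
  ~ (forall u v, `|u - x| < e -> `|v - y| < e -> qev q u v = 0).
Proof.
case: q => [[[a b] c] d] q0 e0 H; pose t := e / 2.
have t0 : t != 0 by rewrite mulf_neq0 ?gt_eqF// invr_gt0.
have te : `|t| < e by rewrite gtr0_norm ?divr_gt0// /t; lra.
have xx (r : R) : `|r - r| < e by rewrite subrr normr0.
have xp (r : R) : `|r + t - r| < e by rewrite addrAC subrr add0r.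
have xm (r : R) : `|r - t - r| < e by rewrite addrAC subrr add0r normrN.
move: (H x y (xx _) (xx _)) (H _ y (xp _) (xx _)) (H _ y (xm _) (xx _))
  (H x _ (xx _) (xp _)).
rewrite /qev => h1 h2 h3 h4.
have /eqP : a%:~R * t ^+ 2 = 0 by lra.
rewrite mulf_eq0 expf_eq0/= (negbTE t0) orbF => a0; rewrite (eqP a0) in h1 h2 h3 h4.
have /eqP : b%:~R * t = 0 by lra.
rewrite mulf_eq0 (negbTE t0) orbF => b0.
have /eqP : c%:~R * t = 0 by lra.
rewrite mulf_eq0 (negbTE t0) orbF => c0.
by move: q0 a0 b0 c0; rewrite /qnonconst !intr_eq0 => /or3P[]/negbTE->.
Qed.

(** Around a common interior point both [q] and its opposite are nonnegative, so [q] would vanish on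
    a whole box. *)
Lemma cell_disjoint l1 l2 :
  has (fun q => qnonconst q && (qopp q \in l2)) l1 ->
  cinterior (cell l1) `&` cinterior (cell l2) = set0.
Proof.
move=> /hasP[q ql1 /andP[q0 ql2]]; apply/seteqP; split=> // z [z1 z2].
have : nbhs (z : R[i]^o) (cell l1 `&` cell l2 : set R[i]^o) by apply: filterI.
move=> /nbhs_planeP[e e0 eq]; apply: (@qev_box0 q (Re z) (Im z) e) => // u v ux vy.
have [] := eq (u +i* v) ux vy => /allP/(_ _ ql1) /= h1 /allP/(_ _ ql2).
by rewrite qev_opp /=; lra.
Qed.

End Quad.

(** * The ten pieces as cells *)

Definition qconj (q : quad) : quad := let: (a, b, c, d) := q in (a, b, - c, d).

(* Quadruples [(a, b, c, d)] stand for [0 <= a |z|^2 + b Re z + c Im z + d];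
   entry [k] of [quads] describes K_(k+1).  Some redundant constraints make every
   pair of pieces separated by a common curve. *)
Definition upper_quads : seq (seq quad) := [::
  [:: (0, 2, 0, 1); (0, -1, 0, 0); (1, 0, -2, 0); (1, 0, 2, 0); (0, 0, -2, 1);
      (0, 0, 2, 1); (-1, -2, 0, 0)];
  [:: (-1, 0, 2, 0); (-1, -2, 0, 0); (1, 2, -2, 1); (0, 0, -2, 1); (0, 2, 0, 1);
      (0, 0, 1, 0)];
  [:: (0, 0, 1, 0); (0, 0, -2, 1); (1, -2, 0, 0); (1, 2, 0, 0); (-1, 0, 0, 1)];
  [:: (0, 2, 0, 1); (-1, -2, 2, -1); (0, 0, -2, 1); (-1, 0, 2, 0); (-1, -2, 0, 0);
      (0, 0, 1, 0)];
  [:: (0, -2, 0, -1); (-1, -2, 2, -1); (0, 0, -2, 1); (-1, 0, 0, 1); (-1, -2, 0, 0);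
      (0, 0, 1, 0)];
  [:: (0, -2, 0, -1); (1, 2, -2, 1); (1, 2, 2, 1); (-1, 0, 0, 1); (0, 0, -2, 1);
      (0, 0, 2, 1); (-1, -2, 0, 0)]].

Definition quads : seq (seq quad) :=
  upper_quads ++ map (map qconj) (take 4 (behead upper_quads)).

Definition curves : seq quad := flatten quads.

Lemma quads_disjoint i j : (i < 10)%N -> (j < 10)%N -> i != j ->
  has (fun q => qnonconst q && (qopp q \in nth [::] quads j)) (nth [::] quads i).
Proof.
move=> i10 j10 ij.
have : all (fun i => all (fun j => (i != j) ==>
   has (fun q => qnonconst q && (qopp q \in nth [::] quads j)) (nth [::] quads i))
     (iota 0 10)) (iota 0 10) by vm_compute.
move=> /allP/(_ i); rewrite mem_iota => /(_ i10)/allP/(_ j).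
by rewrite mem_iota ij => /(_ j10).
Qed.

Lemma curves_nonconst : all qnonconst curves. Proof. by vm_compute. Qed.

Lemma quads_curves i : {subset nth [::] quads i <= curves}.
Proof.
move=> q qi; apply/flattenP; exists (nth [::] quads i) => //; apply: mem_nth.
by rewrite ltnNge; apply: contraL qi => /(nth_default _) ->.
Qed.

Ltac lnra := first [lra | nra].

Section Pieces.
Context {R : realType}.
Implicit Types (x y : R) (z w : R[i]).
Notation Re := (@complex.Re R).
Notation Im := (@complex.Im R).
Notation holds := (@holds R).

Definition in_fund x y :=
  [&& x ^+ 2 + y ^+ 2 <= 1, y <= 1 / 2, - (1 / 2) <= y
    & (x <= 0) || (2 * x <= x ^+ 2 + y ^+ 2)].

Definition fund : set R[i] := [set z | in_fund (Re z) (Im z)].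

(** For positive [x], the bound on [2 * x] comes from combining |z - 1| >= 1 with |z| <= 1. *)
Lemma fund_bounds x y : in_fund x y -> [/\ -1 <= x, 2 * x <= 1,
  x ^+ 2 + y ^+ 2 <= 1, y <= 1 / 2 & - (1 / 2) <= y].
Proof. by case/and4P=> h1 h2 h3 /orP[] h4; split=> //; nra. Qed.

Lemma in_fundN x y : in_fund x (- y) = in_fund x y.
Proof.
by apply/idP/idP; rewrite /in_fund sqrrN => /and4P[? ? ? ?]; apply/and4P; split=> //; lra.
Qed.

Lemma qev_conj q x y : qev (qconj q) x y = qev q x (- y).
Proof. by case: q => [[[a b] c] d]; rewrite /qev /qconj rmorphN; ring. Qed.

Lemma cell_conj l : conj_set (cell l : set R[i]) = cell (map qconj l).
Proof.
apply/seteqP; split=> [_ [[x y] /= h <-]|[x y] h].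
  rewrite /cell /holds /= all_map; apply: sub_all h => q /=.
  by rewrite qev_conj opprK.
exists (x -i* y); last by rewrite /= opprK.
move: h; rewrite /cell /holds /= all_map; apply: sub_all => q /=.
by rewrite qev_conj.
Qed.


Ltac in_fund_cell :=
  move=> [/fund_bounds[? ? ? ? ?]]; intros; rewrite /holds /= /qev; lnra.

Ltac cell_in_fund :=
  rewrite /holds /= /qev => H; split; rewrite /in_fund; lnra.

Lemma sh1E : sh1 fund = cell (nth [::] quads 0).
Proof.
apply/seteqP; split=> -[x y]; rewrite /sh1 /cell /fund /= ?normc_le1 ?normc_ge1 /=.
  in_fund_cell.
cell_in_fund.
Qed.

Lemma sh2E : sh2 fund = cell (nth [::] quads 1).
Proof.
apply/seteqP; split=> -[x y]; rewrite /sh2 /cell /fund /= ?normc_le1 ?normc_ge1 /=.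
  in_fund_cell.
cell_in_fund.
Qed.

Lemma sh3E : sh3 fund = cell (nth [::] quads 2).
Proof.
apply/seteqP; split=> -[x y]; rewrite /sh3 /cell /fund /= ?normc_le1 ?normc_ge1 /=.
  in_fund_cell.
cell_in_fund.
Qed.

Lemma sh4E : sh4 fund = cell (nth [::] quads 3).
Proof.
apply/seteqP; split=> -[x y]; rewrite /sh4 /cell /fund /= ?normc_le1 ?normc_ge1 /=.
  in_fund_cell.
cell_in_fund.
Qed.

Lemma sh5E : sh5 fund = cell (nth [::] quads 4).
Proof.
apply/seteqP; split=> -[x y]; rewrite /sh5 /cell /fund /= ?normc_le1 ?normc_ge1 /=.
  in_fund_cell.
cell_in_fund.
Qed.

Lemma sh6E : sh6 fund = cell (nth [::] quads 5).
Proof.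
apply/seteqP; split=> -[x y]; rewrite /sh6 /cell /fund /= ?normc_le1 ?normc_ge1 /=.
  in_fund_cell.
cell_in_fund.
Qed.

End Pieces.

(** * Covering of K by the pieces, and rigidity of the choice inside K *)

Section Fund.
Context {R : realType}.
Implicit Types (x y : R) (z w h : R[i]).
Notation Re := (@complex.Re R).
Notation Im := (@complex.Im R).

Lemma sh_pieces_fund j : sh_pieces (@fund R) j = cell (nth [::] quads j).
Proof.
case: j => -[|[|[|[|[|[|[|[|[|[|//]]]]]]]]]] j10; rewrite /sh_pieces /=.
all: rewrite ?sh1E ?sh2E ?sh3E ?sh4E ?sh5E ?sh6E ?cell_conj//.
Qed.


(** A decision tree: the line Re z = -1/2 and the circle about -1 + i split off K_4, K_5 and K_6;
    then the circle about -1 splits off K_3, and the circle about i separates K_2 from K_1. *)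
Lemma upper_cover x y : 0 <= y -> in_fund x y ->
  exists2 l, l \in upper_quads & holds l x y.
Proof.
move=> y0 xy; have [x1 x2 s1 y1 y2] := fund_bounds xy.
case/and4P: xy => _ _ _ x3.
have pick k : (k < 6)%N -> holds (nth [::] upper_quads k) x y ->
    exists2 l, l \in upper_quads & holds l x y.
  by move=> k6 hk; exists (nth [::] upper_quads k) => //; exact: mem_nth.
have [xh|xh] := lerP (- (1 / 2)) x; last first.
  have [d|d] := lerP (x ^+ 2 + y ^+ 2 + 2 * x - 2 * y + 1) 0.
    by apply: (pick 4%N) => //; rewrite /holds /= /qev; lra.
  by apply: (pick 5%N) => //; rewrite /holds /= /qev; lra.
have [d|d] := lerP (x ^+ 2 + y ^+ 2 + 2 * x - 2 * y + 1) 0.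
  by apply: (pick 3%N) => //; rewrite /holds /= /qev; lra.
have [t|t] := lerP 0 (x ^+ 2 + y ^+ 2 + 2 * x).
  by apply: (pick 2%N) => //; rewrite /holds /= /qev; case/orP: x3 => ?; lnra.
have xn : x <= 0 by case/orP: x3 => // ?; nra.
have [e|e] := lerP (x ^+ 2 + y ^+ 2) (2 * y).
  by apply: (pick 1%N) => //; rewrite /holds /= /qev; lra.
by apply: (pick 0%N) => //; rewrite /holds /= /qev; lra.
Qed.

Lemma fund_cells : (\bigcup_(j : 'I_10) cell (nth [::] quads j)) = fund :> set R[i].
Proof.
apply/seteqP; split=> [z [j _]|[x y] xy].
  rewrite -sh_pieces_fund.
  case: j => -[|[|[|[|[|[|[|[|[|[|//]]]]]]]]]] j10; rewrite /sh_pieces /=;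
    first [by case
      | by case=> z' H <-; move: H; case: z' => x y; case; rewrite /fund /= in_fundN].
have [l lq hl] : exists2 l, l \in quads & holds l x y.
  have [y0|y0] := lerP 0 y.
    by have [l lu hl] := upper_cover y0 xy; exists l => //; rewrite mem_cat lu.
  have [||l lu hl] := @upper_cover x (- y); [by lra|by rewrite in_fundN|].
  (* [perm_eq] rather than equality, because conjugation maps the constraint lists of K_1 and K_6 to
     permutations of themselves. *)
  have : all (fun l => has (perm_eq (map qconj l)) quads) upper_quads by vm_compute.
  move=> /allP/(_ l lu)/hasP[l' l'q /perm_all pl']; exists l' => //.
  rewrite /holds -pl' all_map; apply: sub_all hl => q /=.
  by rewrite qev_conj.
have l10 : (index l quads < 10)%N by rewrite (_ : 10%N = size quads) ?index_mem.
by exists (Ordinal l10) => //; rewrite /cell /= nth_index.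
Qed.

Definition strict_fund x y :=
  [&& x ^+ 2 + y ^+ 2 < 1, y < 1 / 2, - (1 / 2) < y
    & (x < 0) || (2 * x < x ^+ 2 + y ^+ 2)].

Lemma int_trichotomy (m : int) : [\/ m = 0, m = -1, 1 <= (m%:~R : R) | m%:~R <= -2 :> R].
Proof.
have [/eqP->|m0] := boolP (m == 0); first by constructor 1.
have [/eqP->|m1] := boolP (m == -1); first by constructor 2.
have [m1'|m1'] := ltP 0 m; [constructor 3|constructor 4].
  by rewrite -[1]/(1%:~R) ler_int.
rewrite (_ : -2 = (-2)%:~R) ?ler_int; first lia.
by rewrite rmorphN.
Qed.

(** Since |y| < 1/2, a nonzero [n] strictly increases the imaginary part in modulus. A nonzero [m]
    then increases the distance to -1/2, except possibly [m = -1] with [2 * x < x ^+ 2 + y ^+ 2],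
    where the translate leaves the unit disc. *)
Lemma strict_fund_unique x y (m n : int) : strict_fund x y ->
  (x + m%:~R) ^+ 2 + (y + n%:~R) ^+ 2 <= 1 ->
  (x + m%:~R + 1 / 2) ^+ 2 + (y + n%:~R) ^+ 2 <= (x + 1 / 2) ^+ 2 + y ^+ 2 ->
  m = 0 /\ n = 0.
Proof.
move=> /and4P[s1 y1 y2 xs] h1 h2.
have n0 : n = 0 \/ 0 < (n%:~R : R) ^+ 2 + 2 * y * n%:~R.
  case: (int_trichotomy n) => [->|->|?|?]; [by left|right|right|right].
  - by rewrite rmorphN; lra.
  - nra.
  - nra.
have nge : 0 <= (n%:~R : R) ^+ 2 + 2 * y * n%:~R.
  by case: n0 => [->|/ltW//]; rewrite mulr0z; lra.
have m0 : m = 0.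
  case: (int_trichotomy m) => [//|me|m1|m2]; exfalso.
  - by rewrite me in h1 h2; case/orP: xs => xs; lra.
  - have : 0 <= (m%:~R - 1) * (m%:~R : R) by nra.
    by nra.
  - case/orP: xs => xs; nra.
by split=> //; case: n0 => // n0; exfalso; move: h2; rewrite m0 mulr0z; lra.
Qed.

Lemma gaussianP h : gaussian_integer h <->
  exists m n : int, h = (m%:~R : R) +i* n%:~R.
Proof.
split=> [[/intrP[m hm] /intrP[n hn]]|[m [n ->]]]; last by split; exact: intr_int.
by exists m, n; case: h hm hn => a b /= -> ->.
Qed.

Lemma half_complex : 1 / 2 = (1 / 2)%:C :> R[i].
Proof. by rewrite fmorph_div rmorph1 rmorph_nat. Qed.

Lemma Re_half (w : R[i]) : Re (w + 1 / 2) = Re w + 1 / 2.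
Proof. by rewrite half_complex; case: w. Qed.

Lemma Im_half (w : R[i]) : Im (w + 1 / 2) = Im w.
Proof. by rewrite half_complex; case: w => x y /=; rewrite addr0. Qed.

Lemma normc_le_sqr z w : (`|z| <= `|w|) =
  (Re z ^+ 2 + Im z ^+ 2 <= Re w ^+ 2 + Im w ^+ 2).
Proof. by rewrite !normc_def lecR ler_sqrt// addr_ge0// sqr_ge0. Qed.

(** The point [h] is itself a candidate because |w| < 1, so the chosen point is at least as good as
    [h], and uniqueness makes them equal. *)
Lemma fl_strict fl w h : shifted_hurwitz fl -> gaussian_integer h ->
  strict_fund (Re w) (Im w) -> fl (w + h) = h.
Proof.
move=> hfl hh sw; have [hg h1 h2] := hfl (w + h).
have /and4P[s1 _ _ _] := sw.
have := h2 h hh; rewrite addrK normc_le1 => /(_ (ltW s1)).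
rewrite normc_le_sqr !Re_half !Im_half; move: h1; rewrite normc_le1.
have [m [n em]] := (gaussianP h).1 hh; have [m' [n' em']] := (gaussianP _).1 hg.
rewrite em' em; clear hg hh em em' h2 s1; case: w sw => x y /= sw h1 h2.
have [] := @strict_fund_unique x y (m - m') (n - n') sw.
- by move: h1; rewrite !rmorphB /= !addrA.
- by move: h2; rewrite !rmorphB /= !addrA.
by move=> /eqP; rewrite subr_eq0 => /eqP -> /eqP; rewrite subr_eq0 => /eqP ->.
Qed.


End Fund.

(** * Identification of the fundamental set *)

Section Fund.
Context {R : realType}.
Implicit Types (x y : R) (z w h : R[i]).
Notation Re := (@complex.Re R).
Notation Im := (@complex.Im R).

Lemma image_fund (fl : R[i] -> R[i]) u : shifted_hurwitz fl -> fund (u - fl u).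
Proof.
move=> hfl; have [hg h1 h2] := hfl u.
have cand (m n : int) :
    (Re (u - fl u) + m%:~R) ^+ 2 + (Im (u - fl u) + n%:~R) ^+ 2 <= 1 ->
    (Re (u - fl u) + 1 / 2) ^+ 2 + Im (u - fl u) ^+ 2 <=
    (Re (u - fl u) + m%:~R + 1 / 2) ^+ 2 + (Im (u - fl u) + n%:~R) ^+ 2.
  move=> mn; pose k : R[i] := m%:~R +i* n%:~R.
  have gk : gaussian_integer (fl u - k).
    have [m' [n' em']] := (gaussianP _).1 hg.
    by apply/gaussianP; exists (m' - m), (n' - n); rewrite em' !rmorphB.
  have uk : u - (fl u - k) = (u - fl u) + k by rewrite opprB addrA addrAC.
  have := h2 _ gk; rewrite uk normc_le1 normc_le_sqr !Re_half !Im_half.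
  by move: (u - fl u) mn => [x y] /= mn; exact.
move: h1; rewrite normc_le1 /fund /=.
move: (Re (u - fl u)) (Im (u - fl u)) cand => x y cand xy.
(* The competitors are [fl u] shifted by i, -i and 1. Violating one of the last three constraints of
   [in_fund] would make the matching competitor admissible and strictly better. *)
have c1 := cand 0 (-1); have c2 := cand 0 1; have c3 := cand (-1) 0.
move: c1 c2 c3; rewrite !rmorphN !mulr0z !mulr1z !addr0 => c1 c2 c3.
apply/and4P; split=> //.
- rewrite leNgt; apply/negP => y1.
  by have : x ^+ 2 + (y - 1) ^+ 2 <= 1; [lra|move=> /c1; lra].
- rewrite leNgt; apply/negP => y1.
  by have : x ^+ 2 + (y + 1) ^+ 2 <= 1; [lra|move=> /c2; lra].
- have [//|x0 /=] := lerP x 0; rewrite leNgt; apply/negP => x1.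
  by have : (x - 1) ^+ 2 + y ^+ 2 <= 1; [lra|move=> /c3; lra].
Qed.

Lemma strict_fund_near x y (e : R) : in_fund x y -> 0 < e ->
  exists x' y', [/\ strict_fund x' y', `|x' - x| < e & `|y' - y| < e].
Proof.
move=> xy e0; have [x1 x2 s1 y1 y2] := fund_bounds xy.
have [d [d0 d1 de]] : exists d : R, [/\ 0 < d, 4 * d <= 1 & 4 * d <= e].
  have [e1|e1] := lerP e 1; first by exists (e / 4); split; lra.
  by exists (1 / 4); split; lra.
have yd : (1 - d) * y < 1 / 2 /\ - (1 / 2) < (1 - d) * y by split; nra.
have ye : `|(1 - d) * y - y| < e by rewrite ltr_norml; apply/andP; split; nra.
have [x0|x0] := lerP x 0.
  (* A contraction towards the point -1/2 with factor [1 - d]. *)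
  exists ((1 - d) * x - d / 2), ((1 - d) * y); split=> //; last first.
    by rewrite ltr_norml; apply/andP; split; nra.
  apply/and4P; split; try by case: yd.
    have : 0 <= (1 - d) ^+ 2 * (1 - (x ^+ 2 + y ^+ 2)).
      by rewrite mulr_ge0 ?sqr_ge0//; lra.
    have : 0 <= d * (1 - d) * (x + 1) by rewrite !mulr_ge0//; lra.
    by nra.
  by apply/orP; left; nra.
have xs : 2 * x <= x ^+ 2 + y ^+ 2.
  by case/and4P: xy => _ _ _ /orP[]//; lra.
set t := 1 - d in yd ye *.
have [t0 t1] : 0 < t /\ t < 1 by rewrite /t; split; lra.
have t2 : 0 < t ^+ 2 by rewrite exprn_gt0.
have t21 : t ^+ 2 < 1 by rewrite expr_lt1// ltW.
have t3 : 0 < t ^+ 3 by rewrite exprn_gt0.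
have t31 : t ^+ 3 < 1 by rewrite expr_lt1// ltW.
have t41 : t ^+ 4 < 1 by rewrite expr_lt1// ltW.
(* Uniform scaling would push points of the circle |z - 1| = 1 into the open disc. Shrinking [x]
   faster than [y] moves them outwards, as the factorization below shows. *)
exists (t ^+ 3 * x), (t * y); split=> //; last first.
  have -> : t ^+ 3 * x - x = - (x * (1 - t) * (1 + t + t ^+ 2)) by ring.
  rewrite normrN gtr0_norm; last by rewrite !mulr_gt0//; lra.
  have : x * (1 - t) <= (1 - t) / 2 by nra.
  have : 0 <= x * (1 - t) by apply: mulr_ge0; lra.
  by rewrite /t in t0 t1 t2 t21 *; nra.
apply/and4P; split; try by case: yd.
  have : 0 <= x ^+ 2 * (t ^+ 2 * (1 - t ^+ 4)).
    by rewrite !mulr_ge0 ?sqr_ge0//; lra.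
  have : 0 <= t ^+ 2 * (1 - (x ^+ 2 + y ^+ 2)) by rewrite mulr_ge0 ?sqr_ge0//; lra.
  by nra.
apply/orP; right; rewrite -subr_gt0.
have -> : (t ^+ 3 * x) ^+ 2 + (t * y) ^+ 2 - 2 * (t ^+ 3 * x) =
  t ^+ 2 * ((x ^+ 2 + y ^+ 2 - 2 * x)
    + x * (1 - t) * (2 - x * (1 + t + t ^+ 2 + t ^+ 3))).
  by ring.
apply: mulr_gt0 => //; apply: ltr_wpDl; first lra.
apply: mulr_gt0; first by apply: mulr_gt0; lra.
have : x * (1 + t + t ^+ 2 + t ^+ 3) <= 1 / 2 * (1 + t + t ^+ 2 + t ^+ 3).
  by rewrite ler_wpM2r; lra.
by lra.
Qed.

Lemma cclosed_fund : cclosed (@fund R).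
Proof.
pose l : seq quad := [:: (-1, 0, 0, 1); (0, 0, -2, 1); (0, 0, 2, 1)].
rewrite (_ : fund = cell ((0, -1, 0, 0) :: l) `|` cell ((1, -2, 0, 0) :: l)).
  by apply: closedU; exact: cclosed_cell.
apply/seteqP; split=> -[x y]; rewrite /fund /cell /holds /qev /=.
  move=> /and4P[? ? ? /orP[]?]; [left|right]; repeat (apply/andP; split=> //); lra.
by case=> /and5P[? ? ? ? _]; apply/and4P; split; try lra;
  apply/orP; first [by left; lra | by right; lra].
Qed.

(** One inclusion uses that [fund] is closed. For the other, the choice is 0 at points of
    [strict_fund], so they are their own remainders, and they are dense in [fund]. *)
Lemma fundamental_setE (fl : R[i] -> R[i]) : shifted_hurwitz fl ->
  fundamental_set fl = fund.
Proof.
move=> hfl; apply/seteqP; split=> z.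
  move=> zK; apply: cclosed_fund; move: zK; apply: closureS => _ [u _ <-].
  exact: image_fund.
move=> fz; apply/cclosureP => e e0.
have [x [y [sxy xe ye]]] := strict_fund_near fz e0.
exists (x +i* y); split=> //; exists (x +i* y) => //.
have -> : fl (x +i* y) = 0; last by rewrite subr0.
rewrite -[x +i* y]addr0; apply: fl_strict => //.
by apply/gaussianP; exists 0, 0.
Qed.

End Fund.

(* [z |-> -1 / z] exchanges the coefficients of [|z|^2] and of [1]. *)
Definition qinv (q : quad) : quad := let: (a, b, c, d) := q in (d, - b, c, a).

(** The permutation of zero-based piece indices induced by conjugation: K_1 and K_6 are fixed, the
    others are swapped in pairs. *)
Definition conj_index (k : nat) : nat := nth 0%N [:: 0; 6; 7; 8; 9; 5; 1; 2; 3; 4]%N k.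

Lemma quads_conj k : (k < 10)%N ->
  perm_eq (nth [::] quads (conj_index k)) (map qconj (nth [::] quads k)).
Proof.
move=> k10.
have : all (fun k => perm_eq (nth [::] quads (conj_index k))
  (map qconj (nth [::] quads k))) (iota 0 10) by vm_compute.
by move=> /allP/(_ k); rewrite mem_iota; apply.
Qed.

(** * Reduction of buildability to statements about Gaussian translates *)

Section Gauss.
Context {R : realType}.
Implicit Types (x y : R) (z w u h : R[i]) (fl : R[i] -> R[i]).
Implicit Types (l : seq quad) (J : seq nat).
Notation Re := (@complex.Re R).
Notation Im := (@complex.Im R).
Notation holds := (@holds R).
Notation qev := (@qev R).

(** Multiplying by |u|^2 > 0 clears denominators: -1/u has coordinates -Re u / |u|^2 and Im u /
    |u|^2, and squared modulus 1 / |u|^2. *)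
Lemma qev_inv q u : u != 0 ->
  (0 <= qev q (Re (-1 / u)) (Im (-1 / u))) = (0 <= qev (qinv q) (Re u) (Im u)).
Proof.
case: u => a b u0; have n0 : 0 < a ^+ 2 + b ^+ 2.
  rewrite lt_def addr_ge0 ?sqr_ge0// andbT paddr_eq0 ?sqr_ge0// !sqrf_eq0.
  by move: u0; rewrite eq_complex.
have [-> ->] : Re (-1 / (a +i* b)) = - a / (a ^+ 2 + b ^+ 2) /\
    Im (-1 / (a +i* b)) = b / (a ^+ 2 + b ^+ 2).
  by split; rewrite mulN1r /= ?mulNr ?opprK.
rewrite -(pmulr_lge0 _ n0).
suff -> : qev q (- a / (a ^+ 2 + b ^+ 2)) (b / (a ^+ 2 + b ^+ 2)) * (a ^+ 2 + b ^+ 2)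
  = qev (qinv q) a b by [].
case: q => [[[A B] C] D]; rewrite /qev /qinv rmorphN /=.
by field; rewrite gt_eqF.
Qed.

Lemma holds_inv l u : u != 0 ->
  holds l (Re (-1 / u)) (Im (-1 / u)) = holds (map qinv l) (Re u) (Im u).
Proof. by move=> u0; rewrite /holds all_map; apply: eq_all => q; exact: qev_inv. Qed.

(* Together, [covers] and [avoids] say that G(cell l) is up to a null set the union
   of the pieces in [J]: points [z] of [cell l] are written [-1 / (w + h)] with
   [h = m + n i] and [w = x + y i]. *)
Definition covers l J := forall k x y, k \in J -> holds (nth [::] quads k) x y ->
  exists m n : int, holds (map qinv l) (x + m%:~R) (y + n%:~R).

Definition avoids l J := forall k x y (m n : int), (k < 10)%N -> k \notin J ->
  (forall q, q \in nth [::] quads k -> 0 < qev q x y) ->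
  ~ holds (map qinv l) (x + m%:~R) (y + n%:~R).

(** The boundary curves of K and the imaginary axis all occur in [curves], so every weak inequality
    becomes strict. *)
Lemma generic_strict_fund w : ~ on_curves curves w -> fund w ->
  strict_fund (Re w) (Im w).
Proof.
case: w => x y /negP/hasPn wN /and4P[/= s1 y1 y2 xs].
have c a b c d : (a, b, c, d) \in curves -> qev (a, b, c, d) x y != 0.
  by move=> /wN.
apply/and4P; split; rewrite lt_neqAle ?s1 ?y1 ?y2 ?andbT.
- by apply: contra (c (-1) 0 0 1 isT) => /eqP e; apply/eqP; rewrite /qev; lra.
- by apply: contra (c 0 0 (-2) 1 isT) => /eqP e; apply/eqP; rewrite /qev; lra.
- by apply: contra (c 0 0 2 1 isT) => /eqP e; apply/eqP; rewrite /qev; lra.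
have -> : x != 0.
  by apply: contra (c 0 (-1) 0 0 isT) => /eqP e; apply/eqP; rewrite /qev; lra.
have s2 : 2 * x != x ^+ 2 + y ^+ 2.
  by apply: contra (c 1 (-2) 0 0 isT) => /eqP e; apply/eqP; rewrite /qev; lra.
by case/orP: xs => [->//|xs]; rewrite [_ < _ + _]lt_neqAle s2 xs orbT.
Qed.

Lemma buildable_cell fl l J : shifted_hurwitz fl -> covers l J -> avoids l J ->
  buildable (gauss_map fl @` cell l) (fun j : 'I_10 => cell (nth [::] quads j)).
Proof.
move=> hfl cJ aJ; exists [set j : 'I_10 | val j \in J].
apply: negligibleS (on_curves_null curves_nonconst).
move=> [x y] /=; rewrite /setU /setD /=.
set w := x +i* y => H; apply: contrapT => wN; case: H => -[].
  move=> [z zl]; rewrite /gauss_map; case: eqVneq => [_ w0 _|z0 wE wJ].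
    (* The exceptional value G(0) = 0 lies on the imaginary axis, one of the discarded curves. *)
    apply: wN; rewrite -w0; apply/hasP; exists (0, -1, 0, 0) => //.
    by rewrite /qev /= !mulr0z !mul0r mulr0 !addr0.
  have fw : fund w by rewrite -wE; exact: image_fund.
  have := fw; rewrite -fund_cells => -[k _ wk]; pose u := -1 / z.
  have [m [n flE]] := (gaussianP _).1 (let: And3 g _ _ := hfl u in g).
  have uE : u = (x + m%:~R) +i* (y + n%:~R).
    by rewrite -[u](subrK (fl u)) wE flE.
  apply: (aJ k x y m n) => //.
  - by apply/negP => kJ; apply: wJ; exists k.
  - exact: (cell_generic (@quads_curves k) wN wk).
  - have := zl; rewrite /cell /=.
    have -> : z = -1 / u by rewrite /u; field.
    have u0 : u != 0 by rewrite mulf_neq0 ?invr_eq0 ?oppr_eq0 ?oner_eq0.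
    by rewrite holds_inv ?uE// -uE.
move=> [k kJ wk] wG; apply: wG.
have fw : fund w by rewrite -fund_cells; exists k.
have sw := generic_strict_fund wN fw.
have [m [n hmn]] := cJ k x y kJ wk.
pose h : R[i] := m%:~R +i* n%:~R.
(* Since |Im w| < 1/2, a zero sum would force [n = 0] and put [w] on the real axis, also a discarded
   curve. *)
have wh0 : w + h != 0.
  have /and4P[_ /= y1 y2 _] := sw.
  rewrite eq_complex negb_and; apply/orP; right => /=; apply/eqP => yn.
  have n0 : n = 0.
    case: (@int_trichotomy R n) => // [ne|n1|n1]; exfalso; try lra.
    by rewrite ne rmorphN in yn; lra.
  apply: wN; apply/hasP; exists (0, 0, 1, 0) => //.
  by move: yn; rewrite n0 mulr0z addr0 /qev /= => ->; apply/eqP; lra.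
exists (-1 / (w + h)); first exact: etrans (holds_inv l wh0) hmn.
rewrite /gauss_map ifF; last first.
  by apply/negbTE; rewrite mulf_neq0 ?invr_eq0 ?oppr_eq0 ?oner_eq0.
have -> : -1 / (-1 / (w + h)) = w + h by field.
rewrite fl_strict ?addrK//; apply/gaussianP; by exists m, n.
Qed.

End Gauss.

(** * Explicit shifts showing what each image contains *)

Section Cover.
Context {R : realType}.
Implicit Types (x y : R) (l : seq quad) (J : seq nat).
Notation holds := (@holds R).
Notation qev := (@qev R).

Lemma holds_conj l x y : holds (map qconj l) x y = holds l x (- y).
Proof. by rewrite /holds all_map; apply: eq_all => q; exact: congr1 (qev_conj _ _ _). Qed.

Lemma conj_index_lt k : (k < 10)%N -> (conj_index k < 10)%N.
Proof. by do 10 (case: k => [|k]//). Qed.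

Lemma conj_indexK k : (k < 10)%N -> conj_index (conj_index k) = k.
Proof. by do 10 (case: k => [|k]//). Qed.

Definition conj_stable J := all (fun k => (k < 10)%N && (conj_index k \in J)) J.

Lemma qinv_conj l : map qinv (map qconj l) = map qconj (map qinv l).
Proof. by rewrite -!map_comp; apply: eq_map => -[[[a b] c] d]. Qed.

(** Since [qinv] commutes with [qconj], it suffices to conjugate both the point and its shift. *)
Lemma covers_conj l J : conj_stable J -> @covers R l J -> @covers R (map qconj l) J.
Proof.
move=> /allP sJ cJ k x y kJ; have /andP[k10 k'J] := sJ _ kJ.
have := perm_all (fun q => 0 <= qev q x (- y)) (quads_conj k10).
rewrite -!/(holds _ _ _) holds_conj opprK => <- /(cJ _ _ _ k'J)[m [n mn]].
exists m, (- n); rewrite qinv_conj holds_conj opprD rmorphN opprK.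
exact: mn.
Qed.

Lemma avoids_conj l J : conj_stable J -> @avoids R l J -> @avoids R (map qconj l) J.
Proof.
move=> /allP sJ aJ k x y m n k10 kJ kxy.
rewrite qinv_conj holds_conj opprD -rmorphN.
apply: (aJ (conj_index k)) => [|//|q].
- exact: conj_index_lt.
- by apply: contra kJ => /sJ/andP[_]; rewrite conj_indexK.
rewrite (perm_mem (quads_conj k10)) => /mapP[p pk ->].
by rewrite qev_conj opprK; exact: kxy.
Qed.

Lemma avoids_all l : @avoids R l (iota 0 10).
Proof. by move=> k x y m n k10; rewrite mem_iota k10. Qed.

Lemma covers_fund l J : (forall k, k \in J -> (k < 10)%N) ->
  (forall x y, in_fund x y ->
    exists m n : int, holds (map qinv l) (x + m%:~R) (y + n%:~R)) ->
  @covers R l J.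
Proof.
move=> J10 H k x y /J10 k10 kxy; apply: H.
suff : fund (x +i* y) by [].
by rewrite -fund_cells; exists (Ordinal k10).
Qed.

Lemma iota10 k : k \in iota 0 10 -> (k < 10)%N. Proof. by rewrite mem_iota. Qed.

Ltac hit m n := exists m, n; rewrite /holds /= /qev; lnra.

Lemma covers0 : @covers R (nth [::] quads 0) (iota 0 10).
Proof.
apply: covers_fund iota10 _ => x y /fund_bounds[x1 x2 s1 y1 y2].
(* The image of K_1 under -1/z is the part of the half-strip Re u >= 1/2, |Im u| <= 1/2 outside the
   open unit discs about 1, i and -i. It contains K + 3. *)
by hit (3 : int) (0 : int).
Qed.

Lemma covers1 : @covers R (nth [::] quads 1) (iota 0 10).
Proof.
apply: covers_fund iota10 _ => x y /fund_bounds[x1 x2 s1 y1 y2].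
by hit (3 : int) (3 : int).
Qed.

Lemma covers2 : @covers R (nth [::] quads 2) (iota 0 10).
Proof.
apply: covers_fund iota10 _ => x y /fund_bounds[x1 x2 s1 y1 y2].
(* The image of K_3 under -1/z lies in the strip |Re u| <= 1/2, narrower than K, hence two
   shifts. *)
by have [xh|xh] := lerP (- (1 / 2)) x; [hit (0 : int) (3 : int)|hit (1 : int) (3 : int)].
Qed.

(** The image of K_4 under -1/z is bounded: the unit disc about 1 + i without the open unit discs
    about 1 and i. The shift therefore depends on the piece. *)
Lemma covers3 : @covers R (nth [::] quads 3) (iota 0 10).
Proof.
move=> [|[|[|[|[|[|[|[|[|[|k]]]]]]]]]] x y // _; rewrite {1}/holds /= /qev => H.
- hit (2 : int) (1 : int).
- hit (2 : int) (1 : int).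
- hit (1 : int) (1 : int).
- hit (2 : int) (1 : int).
- hit (2 : int) (1 : int).
- hit (2 : int) (1 : int).
- hit (1 : int) (2 : int).
- hit (1 : int) (2 : int).
- hit (2 : int) (2 : int).
- hit (2 : int) (2 : int).
Qed.

(** Here the image under -1/z lies in the lens common to the unit discs about 1 and 1 + i, outside
    the open unit discs about 0 and i. *)
Lemma covers4 : @covers R (nth [::] quads 4) [:: 2; 3; 4; 7; 8; 9]%N.
Proof.
move=> [|[|[|[|[|[|[|[|[|[|k]]]]]]]]]] x y // _; rewrite {1}/holds /= /qev => H.
- hit (1 : int) (0 : int).
- hit (2 : int) (0 : int).
- hit (2 : int) (0 : int).
- hit (1 : int) (1 : int).
- hit (2 : int) (1 : int).
- hit (2 : int) (1 : int).
Qed.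

Lemma covers5 : @covers R (nth [::] quads 5) [:: 0; 1; 5; 6]%N.
Proof.
move=> [|[|[|[|[|[|[|[|[|[|k]]]]]]]]]] x y // _; rewrite {1}/holds /= /qev => H;
  hit (2 : int) (0 : int).
Qed.

End Cover.

(** * Exclusion of the other pieces from G(K_5) and G(K_6) *)

Section Avoid.
Context {R : realType}.
Implicit Types (x y : R).
Notation holds := (@holds R).
Notation qev := (@qev R).

Lemma int_range (m a b : int) :
  (a%:~R : R) < m%:~R -> m%:~R < (b%:~R : R) -> a < m < b.
Proof. by rewrite !ltr_int => -> ->. Qed.

(** The hypotheses are strict inequalities shared by the interiors of K_1, K_2, K_6 and K_7, so one
    argument serves all four. *)
Lemma avoid4_translate x y (m n : int) :
  [&& x ^+ 2 + y ^+ 2 < 1, 2 * y < 1, -1 < 2 * y, x ^+ 2 + y ^+ 2 + 2 * x < 0,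
      0 < x ^+ 2 + y ^+ 2 + 2 * x - 2 * y + 1
    & 0 < x ^+ 2 + y ^+ 2 + 2 * x + 2 * y + 1] ->
  ~ holds (map qinv (nth [::] quads 4)) (x + m%:~R) (y + n%:~R).
Proof.
move=> xy; rewrite /holds /= /qev => H.
have : (-1) < m < 3 by apply: int_range; nra.
have : (-2) < n < 2 by apply: int_range; nra.
move=> nr mr.
have : m = 0 \/ m = 1 \/ m = 2 by move: mr; clear; lia.
have : n = -1 \/ n = 0 \/ n = 1 by move: nr; clear; lia.
(* For each of the nine shifts the constraints are linear in [x], [y] and their squares. *)
by clear nr mr; move: H => /[swap]-[|[]]-> /[swap]-[|[]]->; lra.
Qed.

(** The three alternatives cover K_3 and K_8, then K_4 and K_5, then K_9 and K_10. *)
Lemma avoid5_translate x y (m n : int) :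
  strict_fund x y -> y != 0 ->
  [\/ 0 < x ^+ 2 + y ^+ 2 + 2 * x, x ^+ 2 + y ^+ 2 + 2 * x - 2 * y + 1 < 0
    | x ^+ 2 + y ^+ 2 + 2 * x + 2 * y + 1 < 0] ->
  ~ holds (map qinv (nth [::] quads 5)) (x + m%:~R) (y + n%:~R).
Proof.
move=> /and4P[s1 y1 y2 xs] y0 d; rewrite /holds /= /qev => H.
have xa : -1 < x by clear -s1; nra.
have xb : x < 1 by clear -s1; nra.
have [Xa Xb Ya Yb] : [/\ 0 <= x + m%:~R, x + m%:~R <= 2,
    -1 <= y + n%:~R & y + n%:~R <= 1].
  move: (x + m%:~R) (y + n%:~R) H => X Y H.
  have {H s1 y1 y2 xs y0 d xa xb} c : X ^+ 2 + Y ^+ 2 <= 2 * X by lra.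
  by have := sqr_ge0 X; have := sqr_ge0 Y; have := sqr_ge0 (X - 1); split; nra.
have : (-1) < m < 3 by apply: int_range; lra.
have : (-2) < n < 2 by apply: int_range; lra.
move=> nr mr.
have : m = 0 \/ m = 1 \/ m = 2 by move: mr; clear; lia.
have : n = -1 \/ n = 0 \/ n = 1 by move: nr; clear; lia.
clear xa xb Xa Xb Ya Yb nr mr; move: H => /[swap]-[|[]]-> /[swap]-[|[]]-> H; try lra.
  (* Shift 1: the point is outside the open unit discs about 1, -1, i and -i, so |w|^2 bounds both
     2|x| and 2|y|. With |y| < 1/2 and y nonzero this is impossible. *)
  have s0 : 0 < y ^+ 2 by rewrite exprn_even_gt0.
  have sx : x ^+ 2 + y ^+ 2 - 2 * x >= 0 by case/orP: xs => xs; nra.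
  have : 2 * x ^+ 2 <= x ^+ 2 + y ^+ 2 by nra.
  nra.
(* Shift 2: each alternative of [d] negates one of the constraints. *)
by case: d => d; lra.
Qed.

Lemma avoids4 : @avoids R (nth [::] quads 4) [:: 2; 3; 4; 7; 8; 9]%N.
Proof.
move=> [|[|[|[|[|[|[|[|[|[|k]]]]]]]]]] x y m n // _ _ /allP; rewrite /= /qev => H;
  apply: avoid4_translate; lra.
Qed.

Lemma avoids5 : @avoids R (nth [::] quads 5) [:: 0; 1; 5; 6]%N.
Proof.
move=> [|[|[|[|[|[|[|[|[|[|k]]]]]]]]]] x y m n // _ _ /allP; rewrite /= /qev => H;
  apply: avoid5_translate; try (rewrite /strict_fund; lnra); try (apply/eqP => y0; lra);
  first [by constructor 1; lra | by constructor 2; lra | by constructor 3; lra].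
Qed.

End Avoid.

Theorem proposition4p13 (R : realType) (fl : R[i] -> R[i])
    (hfl : shifted_hurwitz fl) :
  finite_building_property fl (sh_pieces (fundamental_set fl)).
Proof.
rewrite (fundamental_setE hfl).
have shE : sh_pieces fund = (fun j => cell (nth [::] quads j)) :> ('I_10 -> set R[i]).
  by apply/funext => j; exact: sh_pieces_fund.
rewrite shE; split=> //; first (rewrite (fundamental_setE hfl); split).
- move=> j; split; first exact: cclosed_cell.
  apply: negligibleS (on_curves_null curves_nonconst) => p.
  move=> /cboundary_cell/hasP[q qj q0]; apply/hasP; exists q => //.
  exact: quads_curves qj.
- by move=> i j ij; apply: cell_disjoint; exact: quads_disjoint.
- exact: fund_cells.
have all10 : conj_stable (iota 0 10) by vm_compute.
case=> -[|[|[|[|[|[|[|[|[|[|//]]]]]]]]]] j10.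
- exact (buildable_cell hfl (@covers0 _) (@avoids_all _ _)).
- exact (buildable_cell hfl (@covers1 _) (@avoids_all _ _)).
- exact (buildable_cell hfl (@covers2 _) (@avoids_all _ _)).
- exact (buildable_cell hfl (@covers3 _) (@avoids_all _ _)).
- exact (buildable_cell hfl (@covers4 _) (@avoids4 _)).
- exact (buildable_cell hfl (@covers5 _) (@avoids5 _)).
- exact (buildable_cell hfl (covers_conj all10 (@covers1 _)) (@avoids_all _ _)).
- exact (buildable_cell hfl (covers_conj all10 (@covers2 _)) (@avoids_all _ _)).
- exact (buildable_cell hfl (covers_conj all10 (@covers3 _)) (@avoids_all _ _)).
(* K_10 is the conjugate of K_5, whose image is symmetric about the real axis, so the same index
   list serves. *)
- have J : conj_stable [:: 2; 3; 4; 7; 8; 9]%N by vm_compute.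
  exact (buildable_cell hfl (covers_conj J (@covers4 _)) (avoids_conj J (@avoids4 _))).
Qed.
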